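(* Let $\iota\colon AdS_3\to AdS_4$ be the inclusion $(u,t,x,y)\mapsto(u,t,x,y,0)$, and let $\mathscr{H}_3\subset AdS_3$ and $\mathscr{H}_4\subset AdS_4$ be the horizons of the BTZ black holes in dimensions $3$ and $4$. Then $$\mathscr{H}_4 = G_{X_{0+}}\cdot\iota(\mathscr{H}_3)\ \cup\ G_{X_{0-}}\cdot\iota(\mathscr{H}_3),$$ where $G_{X_{0\pm}}=\{e^{\alpha X_{0\pm}} : \alpha\in\mathbb{R}\}\subset SO(2,3)$. Moreover, in the ambient space $\mathbb{R}^5$ the horizon has equation $u^2-x^2-z^2=0$, that is, $\mathscr{H}_4=\{(u,t,x,y,z)\in AdS_4 : u^2-x^2-z^2=0\}$.
   Context: For $l\ge 3$, let $AdS_l\subset\mathbb{R}^{l+1}$ be the set of vectors with coordinates $(u,t,x,y,\ldots)$ (for $l=3$: $(u,t,x,y)$; for $l=4$: $(u,t,x,y,z)$) satisfying $u^2+t^2-x^2-y^2-\cdots=1$. The group $SO(2,l-1)$ of determinant-one matrices preserving this quadratic form acts on $AdS_l$, and $AdS_l=SO(2,l-1)/SO(1,l-1)$ via $[g]=g e_u$, $e_u=(1,0,\ldots,0)$; $g$ is called a representative of $v$ if $g e_u=v$. Singularity: $\mathscr{S}_l=\{v\in AdS_l : t^2-y^2=0\}$. Put $BTZ_l=AdS_l\setminus\mathscr{S}_l$ with the induced topology. Light-like geodesics: for a representative $g$ of $v$ and a direction $w\in S^{l-2}\subset\mathbb{R}^{l-1}$, the light-like geodesic from $v$ in direction $w$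 is $s\mapsto g\,(1,-s,s w)^{T}$; its future part is $s>0$. Black hole and free part: a point $v\in BTZ_l$ is free if for every representative $g\in SO(2,l-1)$ of $v$ there is a direction $w\in S^{l-2}$ such that $g(1,-s,sw)^T\notin\mathscr{S}_l$ for all $s>0$. $\mathscr{F}_l$ is the set of free points. The black hole $BH_l=BTZ_l\setminus\mathscr{F}_l$ is thus the set of $v\in BTZ_l$ having a representative $g$ such that for every $w\in S^{l-2}$ there is $s>0$ with $g(1,-s,sw)^T\in\mathscr{S}_l$. Horizon: $\mathscr{H}_l$ is the topological boundary of $BH_l$ in $BTZ_l$. The elements $X_{0\pm}\in\mathfrak{so}(2,3)$ are the linear maps of $\mathbb{R}^5$ $X_{0+}(u,t,x,y,z)=(z,0,z,0,u-x)$ and $X_{0-}(u,t,x,y,z)=(z,0,-z,0,u+x)$. *)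

(* Defs.v *)
From HB Require Import structures.
From mathcomp Require Import all_boot all_order all_algebra.
From mathcomp Require Import all_classical all_reals all_analysis.

Set Implicit Arguments.
Unset Strict Implicit.
Unset Printing Implicit Defensive.

Import Order.TTheory GRing.Theory Num.Theory.
Import numFieldNormedType.Exports.

Local Open Scope classical_set_scope.
Local Open Scope ring_scope.

(* Points of R^(l+1) are columns, with coordinates numbered u = 0, t = 1,
   x = 2, y = 3, z = 4; AdS l and what follows are meant for 3 <= l. *)
Definition coord (R : realType) (n : nat) (v : 'cV[R]_n.+1) (k : nat) : R :=
  v (inord k) 0.

Notation cu v := (coord v 0).
Notation ct v := (coord v 1).
Notation cx v := (coord v 2).
Notation cy v := (coord v 3).
Notation cz v := (coord v 4).

Definition quad (R : realType) (l : nat) (v : 'cV[R]_l.+1) : R :=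
  \sum_(i < l.+1) (if (i < 2)%N then v i 0 ^+ 2 else - v i 0 ^+ 2).

Definition SO (R : realType) (l : nat) : set 'M[R]_l.+1 :=
  [set g | \det g = 1 /\ forall v : 'cV[R]_l.+1, quad (g *m v) = quad v].
Arguments SO R l : clear implicits.

Definition AdS (R : realType) (l : nat) : set 'cV[R]_l.+1 :=
  [set v | quad v = 1].
Arguments AdS R l : clear implicits.

Definition base_point (R : realType) (l : nat) : 'cV[R]_l.+1 :=
  delta_mx ord0 0.
Arguments base_point R l : clear implicits.

Definition representative (R : realType) (l : nat) (v : 'cV[R]_l.+1)
    (g : 'M[R]_l.+1) : Prop :=
  SO R l g /\ g *m base_point R l = v.

Definition singularity (R : realType) (l : nat) : set 'cV[R]_l.+1 :=
  [set v | AdS R l v /\ ct v ^+ 2 - cy v ^+ 2 = 0].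
Arguments singularity R l : clear implicits.

Definition BTZ (R : realType) (l : nat) : set 'cV[R]_l.+1 :=
  AdS R l `\` singularity R l.
Arguments BTZ R l : clear implicits.

Definition sphere (R : realType) (n : nat) : set 'cV[R]_n.+1 :=
  [set w | \sum_(i < n.+1) w i 0 ^+ 2 = 1].
Arguments sphere R n : clear implicits.

(* The column (1, -s, s w), where w : R^(l-1) is typed in R^((l-2)+1). *)
Definition base_ray (R : realType) (l : nat) (w : 'cV[R]_(l.-2.+1)) (s : R) :
    'cV[R]_l.+1 :=
  \col_(i < l.+1) match val i with
                  | 0 => 1
                  | 1 => - s
                  | k.+2 => s * coord w k
                  end.

Definition light_ray (R : realType) (l : nat) (g : 'M[R]_l.+1)
    (w : 'cV[R]_(l.-2.+1)) (s : R) : 'cV[R]_l.+1 :=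
  g *m base_ray w s.

Definition free_part (R : realType) (l : nat) : set 'cV[R]_l.+1 :=
  [set v | BTZ R l v /\
    forall g : 'M[R]_l.+1, representative v g ->
      exists2 w : 'cV[R]_(l.-2.+1), sphere R l.-2 w &
        forall s : R, 0 < s -> ~ singularity R l (light_ray g w s)].
Arguments free_part R l : clear implicits.

Definition black_hole (R : realType) (l : nat) : set 'cV[R]_l.+1 :=
  BTZ R l `\` free_part R l.
Arguments black_hole R l : clear implicits.

Definition boundary (T : topologicalType) (A : set T) : set T :=
  closure A `\` interior A.

(* Topological boundary inside the subspace BTZ.  The library makes the points
   outside BTZ isolated in [subspace BTZ]; as black_hole is included in BTZ,
   none of them is in its boundary. *)
Definition horizon (R : realType) (l : nat) : set 'cV[R]_l.+1 :=
  @boundary (subspace (BTZ R l)) (black_hole R l).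
Arguments horizon R l : clear implicits.

Definition vec5 (R : realType) (u t x y z : R) : 'cV[R]_5 :=
  \col_(i < 5) [:: u; t; x; y; z]`_i.

Definition incl34 (R : realType) (v : 'cV[R]_4) : 'cV[R]_5 :=
  vec5 (cu v) (ct v) (cx v) (cy v) 0.

Definition X0p_map (R : realType) (v : 'cV[R]_5) : 'cV[R]_5 :=
  vec5 (cz v) 0 (cz v) 0 (cu v - cx v).

Definition X0m_map (R : realType) (v : 'cV[R]_5) : 'cV[R]_5 :=
  vec5 (cz v) 0 (- cz v) 0 (cu v + cx v).

Definition mx_of_map (R : realType) (n : nat) (f : 'cV[R]_n -> 'cV[R]_n) :
    'M[R]_n :=
  \matrix_(i, j) f (delta_mx j 0) i 0.

Definition X0p (R : realType) : 'M[R]_5 := mx_of_map (@X0p_map R).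
Definition X0m (R : realType) : 'M[R]_5 := mx_of_map (@X0m_map R).

Lemma X0pE (R : realType) (v : 'cV[R]_5) : X0p R *m v = X0p_map v.
Proof.
apply/colP => i; rewrite !mxE.
under eq_bigr => j _ do rewrite !mxE /coord !mxE.
rewrite !big_ord_recl big_ord0 /coord /=.
have E (k : 'I_5) (m : nat) (h : (m < 5)%N) : m = k -> inord m = k.
  by move=> mk; apply/val_inj; rewrite /= inordK.
rewrite !(@E ord0 0%N) // !(@E (lift ord0 (lift ord0 ord0)) 2%N) //.
rewrite !(@E (lift ord0 (lift ord0 (lift ord0 (lift ord0 ord0)))) 4%N) //.
case: i => m; do 5?[case: m => [|m]] => //= _.
all: by rewrite ?(mul0r, mul1r, add0r, oppr0, addr0, subr0, sub0r, mulN1r).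
Qed.

Lemma X0mE (R : realType) (v : 'cV[R]_5) : X0m R *m v = X0m_map v.
Proof.
apply/colP => i; rewrite !mxE.
under eq_bigr => j _ do rewrite !mxE /coord !mxE.
rewrite !big_ord_recl big_ord0 /coord /=.
have E (k : 'I_5) (m : nat) (h : (m < 5)%N) : m = k -> inord m = k.
  by move=> mk; apply/val_inj; rewrite /= inordK.
rewrite !(@E ord0 0%N) // !(@E (lift ord0 (lift ord0 ord0)) 2%N) //.
rewrite !(@E (lift ord0 (lift ord0 (lift ord0 (lift ord0 ord0)))) 4%N) //.
case: i => m; do 5?[case: m => [|m]] => //= _.
all: by rewrite ?(mul0r, mul1r, add0r, oppr0, addr0, subr0, sub0r, mulN1r).
Qed.

Definition mx_exp (R : realType) (n : nat) (X : 'M[R]_n.+1) : 'M[R]_n.+1 :=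
  limn (series (fun k : nat => k`!%:R^-1 *: X ^+ k)).

Definition one_param (R : realType) (n : nat) (X : 'M[R]_n.+1) :
    set 'M[R]_n.+1 :=
  [set mx_exp (a *: X) | a in [set: R]].

Definition group_image (R : realType) (n : nat) (G : set 'M[R]_n.+1)
    (A : set 'cV[R]_n.+1) : set 'cV[R]_n.+1 :=
  [set g *m v | g in G & v in A].

(* Main.v *)
(* Write a = t + y and b = t - y, so that the singularity is ab = 0.  Let g be a
   representative of v.  The rows of t + y and t - y in g are null vectors of
   Lorentz product 2 whose u-coordinates are a and b.  Divided by a and b they
   become (1, p0, p) and (1, q0, q) with |p|^2 = 1 + p0^2, |q|^2 = 1 + q0^2 and
   p.q = p0 q0 + 1 - 2 / (ab), and the ray of direction w escapes iff w lies in
   both caps p.w >= p0 and q.w >= q0 of the sphere.  If 1 / (ab) <= 1 the caps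
   meet.  If 1 / (ab) > 1 then |p + q| < |p0 + q0|, so they are disjoint as soon as
   p0 + q0 > 0, which a time reversal of g can always achieve.  Hence in every
   dimension the black hole is 0 < t^2 - y^2 < 1 and the horizon t^2 - y^2 = 1. *)
Require Import Defs.
From mathcomp Require Import all_boot all_order all_algebra.
From mathcomp Require Import all_classical all_reals all_analysis.
From mathcomp Require Import ring lra.

Import Order.TTheory GRing.Theory Num.Theory.
Import numFieldNormedType.Exports.

Local Open Scope classical_set_scope.
Local Open Scope ring_scope.

Set Implicit Arguments.
Unset Strict Implicit.
Unset Printing Implicit Defensive.

(** * Isometries of diagonal quadratic forms *)

Section DiagonalForms.
Variables (R : realType) (n : nat).
Implicit Types (s : 'I_n -> R) (u v w : 'cV[R]_n) (g h : 'M[R]_n).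

Definition diag_form s u v : R := \sum_i s i * (u i 0 * v i 0).

Lemma diag_formC s u v : diag_form s u v = diag_form s v u.
Proof. by apply: eq_bigr => i _; rewrite (mulrC (u i 0)). Qed.

Lemma diag_formDl s u v w :
  diag_form s (u + v) w = diag_form s u w + diag_form s v w.
Proof.
by rewrite -big_split; apply: eq_bigr => i _; rewrite !mxE mulrDl mulrDr.
Qed.

Lemma diag_formZl s a u v : diag_form s (a *: u) v = a * diag_form s u v.
Proof. by rewrite big_distrr; apply: eq_bigr => i _; rewrite !mxE /=; ring. Qed.

Lemma diag_formDr s u v w :
  diag_form s w (u + v) = diag_form s w u + diag_form s w v.
Proof. by rewrite diag_formC diag_formDl !(diag_formC s w). Qed.

Lemma diag_formZr s a u v : diag_form s u (a *: v) = a * diag_form s u v.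
Proof. by rewrite diag_formC diag_formZl diag_formC. Qed.

Definition diag_formE := (diag_formDl, diag_formDr, diag_formZl, diag_formZr).

Lemma diag_form_delta s i v : diag_form s (delta_mx i 0) v = s i * v i 0.
Proof.
rewrite /diag_form (bigD1 i) //= mxE !eqxx mul1r big1 ?addr0 // => j ji.
by rewrite mxE (negbTE ji) mul0r mulr0.
Qed.

Lemma diag_form_mx s u v :
  diag_form s u v = (u^T *m diag_mx (\row_i s i) *m v) 0 0.
Proof.
rewrite mxE; apply: eq_bigr => i _.
by rewrite mul_mx_diag !mxE; ring.
Qed.

Definition isometric s g :=
  forall v, diag_form s (g *m v) (g *m v) = diag_form s v v.

Lemma isometricM s g h : isometric s g -> isometric s h -> isometric s (g *m h).
Proof. by move=> gP hP v; rewrite -mulmxA gP hP. Qed.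

Lemma isometric_form s g u v :
  isometric s g -> diag_form s (g *m u) (g *m v) = diag_form s u v.
Proof.
move=> gP; have := gP (u + v); rewrite mulmxDr !diag_formE.
by rewrite !gP (diag_formC s (g *m v)) (diag_formC s v); lra.
Qed.

Lemma isometric_mx s g : isometric s g ->
  g^T *m diag_mx (\row_i s i) *m g = diag_mx (\row_i s i).
Proof.
move=> gP; apply/matrixP => i j.
have := isometric_form (delta_mx i 0) (delta_mx j 0) gP.
have entry (M : 'M[R]_n) :
    ((delta_mx i 0 : 'cV_n)^T *m M *m (delta_mx j 0 : 'cV_n)) 0 0 = M i j.
  by rewrite trmx_delta -rowE -colE !mxE.
by rewrite !diag_form_mx trmx_mul -!(mulmxA _ g^T) !mulmxA -(mulmxA _ _ g)
  -(mulmxA _ _ (_ *m g)) !entry -mulmxA.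
Qed.

Variable s : 'I_n -> R.
Hypothesis s_sq : forall i, s i ^+ 2 = 1.

Let J := diag_mx (\row_i s i).

Lemma diag_sign_sq : J *m J = 1%:M.
Proof.
rewrite mulmx_diag; apply/matrixP => i j; rewrite !mxE -expr2 s_sq.
by [].
Qed.

(** Since [g^T J g = J] and [J J = 1], the matrix [J g^T J] is a left inverse of [g], hence also a
    right inverse, which gives [g J g^T = J]. This carries the form over to the rows of [g]. *)
Lemma isometric_tr g : isometric s g -> isometric s g^T.
Proof.
move=> gP v.
have E : (J *m g^T *m J) *m g = 1%:M.
  by rewrite -!mulmxA (mulmxA g^T) isometric_mx // diag_sign_sq.
rewrite !diag_form_mx trmx_mul trmxK -/J.
suff -> : v^T *m g *m J *m (g^T *m v) = v^T *m (g *m (J *m g^T *m J)) *m J *m v.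
  by rewrite (mulmx1C E) mulmx1.
by rewrite !mulmxA -(mulmxA _ J J) diag_sign_sq mulmx1.
Qed.

Lemma isometric_det g : isometric s g -> \det g ^+ 2 = 1.
Proof.
move=> gP; have := congr1 determinant (isometric_mx gP).
rewrite !det_mulmx det_tr => /eqP.
have J0 : \det J != 0.
  apply/eqP => J0; have := congr1 determinant diag_sign_sq.
  by rewrite det_mulmx det1 J0 mul0r => /eqP; rewrite eq_sym oner_eq0.
move=> /eqP E; apply: (mulIf J0); rewrite mul1r -[RHS]E; ring.
Qed.

Lemma isometricN g : isometric s g -> isometric s (- g).
Proof.
by move=> gP v; rewrite mulNmx -scaleN1r !diag_formE gP mulrA mulrNN !mul1r.
Qed.

Lemma isometric_diag (d : 'rV[R]_n) :
  (forall i, d 0 i ^+ 2 = 1) -> isometric s (diag_mx d).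
Proof.
move=> d_sq v; apply: eq_bigr => i _.
rewrite mul_diag_mx !mxE -[in RHS](mul1r (v i 0 * _)) -(d_sq i); ring.
Qed.

Definition reflection u : 'M[R]_n :=
  1%:M - (2 / diag_form s u u) *: (u *m (u^T *m J)).

Lemma reflectionE u v :
  reflection u *m v = v - (2 / diag_form s u u * diag_form s u v) *: u.
Proof.
rewrite mulmxBl mul1mx -scalemxAl -mulmxA [u^T *m J *m v]mx11_scalar.
by rewrite -diag_form_mx mul_mx_scalar scalerA.
Qed.

Lemma isometric_reflection u : diag_form s u u != 0 -> isometric s (reflection u).
Proof.
move=> u0 v; rewrite reflectionE -scaleNr !diag_formE (diag_formC s v u).
by field.
Qed.

(** If [u - v] is not isotropic, the reflection along it sends [u] to [v]. Otherwise [u + v] is not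
    isotropic, because the norms of [u - v] and [u + v] add up to four times that of [u]; the
    reflection along [u + v] then sends [u] to [- v], and a sign corrects this. *)
Lemma isometric_transitive u v : diag_form s u u = diag_form s v v ->
  diag_form s u u != 0 -> exists2 g, isometric s g & g *m u = v.
Proof.
move=> uv u0.
have [E|d0] := eqVneq (diag_form s (u - v) (u - v)) 0; last first.
  exists (reflection (u - v)); first exact: isometric_reflection.
  rewrite reflectionE.
  suff -> : 2 / diag_form s (u - v) (u - v) * diag_form s (u - v) u = 1.
    by rewrite scale1r opprB addrC subrK.
  move: d0; rewrite -scaleN1r !diag_formE -uv (diag_formC s v u) => d0.
  by field; apply: contra_neq d0 => d0; rewrite -[RHS]d0; ring.
have d0 : diag_form s (u + v) (u + v) != 0.
  move: E u0; rewrite -scaleN1r !diag_formE -uv (diag_formC s v u) => E.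
  by apply: contra_neq => E'; lra.
exists (- reflection (u + v)).
  exact/isometricN/isometric_reflection.
rewrite mulNmx reflectionE.
suff -> : 2 / diag_form s (u + v) (u + v) * diag_form s (u + v) u = 1.
  by rewrite scale1r opprB addrC addKr.
move: d0; rewrite !diag_formE -uv (diag_formC s v u) => d0.
by field; apply: contra_neq d0 => d0; rewrite -[RHS]d0; ring.
Qed.

End DiagonalForms.

(** * Intersections of two caps of a Euclidean sphere *)

Section EuclideanCaps.
Variables (R : realType).

Definition dot n (u v : 'cV[R]_n) : R := diag_form (fun=> 1) u v.

Lemma dotE n (u v : 'cV[R]_n) : dot u v = \sum_i u i 0 * v i 0.
Proof. by apply: eq_bigr => i _; rewrite mul1r. Qed.

Lemma dotC n (u v : 'cV[R]_n) : dot u v = dot v u.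
Proof. exact: diag_formC. Qed.

Lemma dotDl n (u v w : 'cV[R]_n) : dot (u + v) w = dot u w + dot v w.
Proof. exact: diag_formDl. Qed.

Lemma dotZl n a (u v : 'cV[R]_n) : dot (a *: u) v = a * dot u v.
Proof. exact: diag_formZl. Qed.

Lemma dotDr n (u v w : 'cV[R]_n) : dot w (u + v) = dot w u + dot w v.
Proof. exact: diag_formDr. Qed.

Lemma dotZr n a (u v : 'cV[R]_n) : dot u (a *: v) = a * dot u v.
Proof. exact: diag_formZr. Qed.

Definition dot_linear := (dotDl, dotDr, dotZl, dotZr).

Lemma dot_delta n i (v : 'cV[R]_n) : dot (delta_mx i 0) v = v i 0.
Proof. by rewrite /dot diag_form_delta mul1r. Qed.

Lemma dot_mulmx n (g : 'M[R]_n) (u v : 'cV[R]_n) :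
  dot u (g *m v) = dot (g^T *m u) v.
Proof.
rewrite /dot !diag_form_mx.
have -> : diag_mx (\row_i 1) = 1%:M :> 'M[R]_n.
  by apply/matrixP => i j; rewrite !mxE.
by rewrite !mulmx1 trmx_mul trmxK mulmxA.
Qed.

Lemma dot_ge0 n (u : 'cV[R]_n) : 0 <= dot u u.
Proof. by rewrite dotE; apply: sumr_ge0 => i _; rewrite -expr2 sqr_ge0. Qed.

Lemma dot_eq0 n (u : 'cV[R]_n) : dot u u = 0 -> u = 0.
Proof.
rewrite dotE => /eqP; rewrite psumr_eq0 => [/allP E|i _]; last first.
  by rewrite -expr2 sqr_ge0.
apply/colP => i; have := E i (mem_index_enum _).
by rewrite mxE mulf_eq0 orbb => /eqP.
Qed.

Lemma cauchy_schwarz_unit n (u w : 'cV[R]_n) :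
  dot w w = 1 -> dot u w ^+ 2 <= dot u u.
Proof.
move=> w1; have := dot_ge0 (u - dot u w *: w).
rewrite -scaleNr !dot_linear w1 (dotC w u); nra.
Qed.

Lemma unit_orthogonal n (p : 'cV[R]_n.+2) :
  exists2 e : 'cV[R]_n.+2, dot e e = 1 & dot p e = 0.
Proof.
have [e e0 pe] : exists2 e : 'cV[R]_n.+2, dot e e != 0 & dot p e = 0.
  have [p0|p0] := eqVneq (p ord0 0) 0.
    exists (delta_mx ord0 0); last by rewrite dotC dot_delta.
    by rewrite dot_delta mxE !eqxx oner_neq0.
  (* A quarter turn of the projection of [p] on the plane of the first and last coordinates. *)
  exists (p ord_max 0 *: delta_mx ord0 0 - p ord0 0 *: delta_mx ord_max 0).
    rewrite -scaleNr !dot_linear !dot_delta !mxE !eqxx /=.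
    rewrite gt_eqF //; have : 0 < p ord0 0 ^+ 2 by rewrite exprn_even_gt0.
    nra.
  by rewrite -scaleNr !dot_linear !(dotC p) !dot_delta; ring.
exists ((Num.sqrt (dot e e))^-1 *: e); last by rewrite dotZr pe mulr0.
rewrite !dot_linear mulrA -expr2 exprVn sqr_sqrtr ?dot_ge0 //.
by rewrite mulVf.
Qed.

(* The cap [p0 <= dot p w] of the unit sphere has angular radius
   [acos (p0 / |p|)], and [1] is [|p|] times the sine of that radius.  Comparing
   [dot p q] with [p0 * q0 + 1] or [p0 * q0 - 1] amounts to comparing the angle
   of [p] and [q] with the difference or the sum of the radii of the caps. *)
Lemma caps_nested n (p q : 'cV[R]_n) (p0 q0 : R) :
    dot q q = 1 + q0 ^+ 2 -> p0 * q0 + 1 <= dot p q -> p0 <= q0 ->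
  exists2 w, dot w w = 1 & p0 <= dot p w /\ q0 <= dot q w.
Proof.
move=> qq pq le_pq; pose r := Num.sqrt (1 + q0 ^+ 2).
have r2 : r ^+ 2 = 1 + q0 ^+ 2 by rewrite sqr_sqrtr //; nra.
have r0 : 0 < r by rewrite sqrtr_gt0; nra.
have rq : q0 <= r by nra.
(* With [r = |q|], this is the centre of the cap of [q]. It lies in the other cap because [p0 * (r -
   q0) <= q0 * (r - q0) <= r ^+ 2 - q0 ^+ 2 = 1]. *)
exists (r^-1 *: q).
  by rewrite !dot_linear qq -r2; field; rewrite gt_eqF.
rewrite !dot_linear qq -r2; split; last first.
  by rewrite expr2 mulKf // gt_eqF.
rewrite mulrC ler_pdivlMr //; apply: le_trans pq.
have : p0 * (r - q0) <= q0 * (r - q0) by rewrite ler_wpM2r // subr_ge0.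
have : q0 * r <= r * r by rewrite ler_wpM2r // ltW.
nra.
Qed.

(** The common point is sought on the boundary of the cap of [p], in the plane of [p] and [q], on
    the side of [q]. *)
Lemma caps_cross n (p q : 'cV[R]_n.+2) (p0 q0 c : R) :
    dot p p = 1 + p0 ^+ 2 -> dot q q = 1 + q0 ^+ 2 ->
    dot p q = p0 * q0 + 1 - 2 * c -> 0 <= c <= 1 ->
  exists2 w, dot w w = 1 & p0 <= dot p w /\ q0 <= dot q w.
Proof.
move=> pp qq pq /andP[c0 c1].
pose r := Num.sqrt (1 + p0 ^+ 2).
have r2 : r ^+ 2 = 1 + p0 ^+ 2 by rewrite sqr_sqrtr //; nra.
have r0 : 0 < r by rewrite sqrtr_gt0; nra.
have rN0 : r != 0 by rewrite gt_eqF.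
(* The component of [q] orthogonal to [p]; its length [k] satisfies
   [(r * k) ^+ 2 = |p|^2 |q|^2 - (p.q)^2], the Gram determinant. *)
pose q' := q - (dot p q / r ^+ 2) *: p.
have pq' : dot p q' = 0.
  by rewrite /q' -scaleNr !dot_linear pp -r2; field.
pose k := Num.sqrt (dot q' q').
have k2 : k ^+ 2 = dot q' q' by rewrite sqr_sqrtr ?dot_ge0.
have k0 : 0 <= k by exact: sqrtr_ge0.
have qE : q = q' + (dot p q / r ^+ 2) *: p by rewrite /q' subrK.
have rk2 : (r * k) ^+ 2 = r ^+ 2 * (1 + q0 ^+ 2) - dot p q ^+ 2.
  rewrite exprMn k2 -qq /q' -scaleNr !dot_linear (dotC q p) pp -r2.
  by field.
clearbody k r q'.
have [e ee [pe qe]] :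
    exists2 e, dot e e = 1 & dot p e = 0 /\ dot q e = k.
  (* When [q] is parallel to [p], no side is preferred and any unit vector orthogonal to [p]
     serves. *)
  have [kE|kN0] := eqVneq k 0.
    have [e ee pe] := unit_orthogonal p; exists e => //; split=> //.
    have q'0 : q' = 0 by apply: dot_eq0; rewrite -k2 kE expr0n.
    by rewrite qE q'0 add0r dotZl pe mulr0 kE.
  exists (k^-1 *: q'); first by rewrite !dot_linear -k2; field.
  split; first by rewrite dotZr pq' mulr0.
  by rewrite dotC qE !dot_linear -k2 (dotC q') pq' !mulr0 addr0 expr2 mulKf.
exists ((p0 / r ^+ 2) *: p + r^-1 *: e).
  rewrite !dot_linear (dotC e p) pe ee pp -r2.
  transitivity ((p0 ^+ 2 + 1) / r ^+ 2); first by field.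
  by rewrite addrC -r2; field.
rewrite !dot_linear pe qe pp -r2; split.
  by rewrite divfK ?expf_neq0 // mulr0 addr0.
have -> : p0 / r ^+ 2 * dot q p + r^-1 * k = (p0 * dot p q + r * k) / r ^+ 2.
  by rewrite (dotC q); field.
rewrite ler_pdivlMr ?exprn_gt0 // r2 pq.
suff : q0 - p0 * (1 - 2 * c) <= r * k by nra.
have rk0 : 0 <= r * k by rewrite mulr_ge0 // ltW.
rewrite leNgt; apply/negP => lt_rk.
have : (r * k) ^+ 2 < (q0 - p0 * (1 - 2 * c)) ^+ 2.
  by rewrite ltr_pXn2r // ?nnegrE //; lra.
(* Four times this quantity is exactly [(r * k) ^+ 2 - (q0 - p0 * (1 - 2 * c)) ^+ 2]. *)
have : 0 <= (1 + p0 ^+ 2) * (c * (1 - c)).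
  by rewrite !mulr_ge0 ?subr_ge0 // ?addr_ge0 ?sqr_ge0.
by rewrite rk2 r2 pq; nra.
Qed.

(** For [c < 0] the product [dot p q] exceeds [p0 * q0 + 1], and the cap of smaller height contains
    the centre of the other. *)
Lemma caps_meet n (p q : 'cV[R]_n.+2) (p0 q0 c : R) :
    dot p p = 1 + p0 ^+ 2 -> dot q q = 1 + q0 ^+ 2 ->
    dot p q = p0 * q0 + 1 - 2 * c -> c <= 1 ->
  exists2 w, dot w w = 1 & p0 <= dot p w /\ q0 <= dot q w.
Proof.
move=> pp qq pq c1.
have [c0|c0] := leP 0 c; first by apply: (@caps_cross _ _ _ _ _ c); rewrite ?c0.
have [le_pq|/ltW le_qp] := leP p0 q0.
  by apply: caps_nested => //; rewrite pq; lra.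
have [w w1 [qw pw]] : exists2 w, dot w w = 1 & q0 <= dot q w /\ p0 <= dot p w.
  by apply: caps_nested => //; rewrite dotC pq; lra.
by exists w.
Qed.

(** A common [w] has [(p + q).w >= p0 + q0 >= 0], against Cauchy-Schwarz, since
    [|p + q|^2 = (p0 + q0)^2 + 4 (1 - c)]. *)
Lemma caps_disjoint n (p q : 'cV[R]_n) (p0 q0 c : R) (w : 'cV[R]_n) :
    dot p p = 1 + p0 ^+ 2 -> dot q q = 1 + q0 ^+ 2 ->
    dot p q = p0 * q0 + 1 - 2 * c -> 1 < c -> 0 <= p0 + q0 ->
  dot w w = 1 -> p0 <= dot p w -> q0 <= dot q w -> False.
Proof.
move=> pp qq pq c1 pq0 w1 pw qw.
have := cauchy_schwarz_unit (p + q) w1.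
rewrite !dot_linear (dotC q p) pp qq pq; nra.
Qed.

End EuclideanCaps.

(** * The black hole in dimension [l = m + 3] *)

Section BlackHole.
Variables (R : realType) (m : nat).
Notation V := 'cV[R]_m.+4.
Implicit Types (v r : V) (g : 'M[R]_m.+4) (w : 'cV[R]_m.+2) (s : R).

Definition lorentz_sign (i : 'I_m.+4) : R := if (i < 2)%N then 1 else -1.
Notation form := (diag_form lorentz_sign).
Notation ray := (@light_ray R m.+3).

Definition spatial v : 'cV[R]_m.+2 := \col_k v (lift ord0 (lift ord0 k)) 0.

Lemma lorentz_sign_sq i : lorentz_sign i ^+ 2 = 1.
Proof. by rewrite /lorentz_sign; case: ifP => _; rewrite ?sqrrN expr1n. Qed.

Lemma quadE v : quad (l := m.+3) v = form v v.
Proof.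
apply: eq_bigr => i _; rewrite /lorentz_sign.
by case: ifP => _; rewrite ?mul1r ?mulN1r expr2.
Qed.

Lemma SO_isometric g : SO R m.+3 g <-> \det g = 1 /\ isometric lorentz_sign g.
Proof.
by split=> -[g1 gP]; split=> // v; have := gP v; rewrite !quadE.
Qed.

Lemma inord0E n : inord 0 = ord0 :> 'I_n.+1.
Proof. by apply/val_inj; rewrite /= inordK. Qed.

Lemma inord1E n : inord 1 = lift ord0 ord0 :> 'I_n.+2.
Proof. by apply/val_inj; rewrite /= inordK. Qed.

Lemma formE u v :
  form u v = cu u * cu v + ct u * ct v - dot (spatial u) (spatial v).
Proof.
rewrite /diag_form 2!big_ord_recl /lorentz_sign !mul1r -addrA.
rewrite dotE -sumrN /Defs.coord inord0E inord1E; congr (_ + (_ + _)).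
by apply: eq_bigr => k _; rewrite !mxE mulN1r.
Qed.

Lemma dot_split u v :
  dot u v = cu u * cu v + ct u * ct v + dot (spatial u) (spatial v).
Proof.
rewrite !dotE 2!big_ord_recl -addrA /Defs.coord inord0E inord1E.
by congr (_ + (_ + _)); apply: eq_bigr => k _; rewrite !mxE.
Qed.

Lemma cu_base_ray w s : cu (base_ray (l := m.+3) w s) = 1.
Proof. by rewrite /Defs.coord mxE /= inordK. Qed.

Lemma ct_base_ray w s : ct (base_ray (l := m.+3) w s) = - s.
Proof. by rewrite /Defs.coord mxE /= inordK. Qed.

Lemma spatial_base_ray w s : spatial (base_ray (l := m.+3) w s) = s *: w.
Proof.
apply/colP => k; rewrite !mxE /= /Defs.coord; congr (_ * w _ _).
by apply/val_inj; rewrite /= inordK // ltn_ord.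
Qed.

Lemma quad_base_ray w s : dot w w = 1 -> quad (base_ray (l := m.+3) w s) = 1.
Proof.
move=> w1; rewrite quadE formE cu_base_ray ct_base_ray spatial_base_ray.
by rewrite !dot_linear w1; ring.
Qed.

Lemma sphereE w : sphere R m.+1 w <-> dot w w = 1.
Proof.
rewrite dotE /sphere /=.
by under eq_bigr do rewrite expr2.
Qed.

Definition e_t : V := delta_mx (inord 1) 0.
Definition e_y : V := delta_mx (inord 3) 0.

Lemma dot_ty v e : dot (e_t + e *: e_y) v = ct v + e * cy v.
Proof. by rewrite !dot_linear !dot_delta. Qed.

Lemma form_ty e e' : form (e_t + e *: e_y) (e_t + e' *: e_y) = 1 - e * e'.
Proof.
rewrite !diag_formE !diag_form_delta /lorentz_sign !inordK //= !mxE.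
rewrite !eqxx (_ : (inord 1 == inord 3 :> 'I_m.+4) = false) ?andbT; last first.
  by apply/eqP => /(congr1 val); rewrite /= !inordK.
rewrite (_ : (inord 3 == inord 1 :> 'I_m.+4) = false); last first.
  by apply/eqP => /(congr1 val); rewrite /= !inordK.
by rewrite /=; ring.
Qed.

(* [ty_row g e] is the row [t + e y] of [g]: a null vector for [e = 1] and
   [e = -1], whose [u]-coordinate is the value of [t + e y] at [g e_u]. *)
Definition ty_row g (e : R) : V := g^T *m (e_t + e *: e_y).

Lemma cu_ty_row g e :
  cu (ty_row g e) = ct (g *m base_point R m.+3) + e * cy (g *m base_point R m.+3).
Proof.
rewrite -dot_ty dot_mulmx -/(ty_row g e) dotC /base_point dot_delta.
by rewrite /Defs.coord inord0E.
Qed.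

Lemma light_ray_ty g w s e :
  ct (ray g w s) + e * cy (ray g w s) = cu (ty_row g e) -
    s * (ct (ty_row g e) - dot (spatial (ty_row g e)) w).
Proof.
rewrite -!dot_ty /light_ray dot_mulmx -/(ty_row g e) dot_split.
by rewrite cu_base_ray ct_base_ray spatial_base_ray dotZr; ring.
Qed.

Lemma form_ty_row g e e' : isometric lorentz_sign g ->
  form (ty_row g e) (ty_row g e') = 1 - e * e'.
Proof.
move=> gP; rewrite /ty_row isometric_form ?form_ty //.
by apply: isometric_tr => //; apply: lorentz_sign_sq.
Qed.

Lemma singularity_light_ray g w s : isometric lorentz_sign g -> dot w w = 1 ->
  singularity R m.+3 (ray g w s) <->
  (ct (ray g w s) + 1 * cy (ray g w s)) *
  (ct (ray g w s) + -1 * cy (ray g w s)) = 0.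
Proof.
move=> gP w1; set v := ray g w s.
have v1 : AdS R m.+3 v.
  by rewrite /AdS /= quadE /v /light_ray gP -quadE quad_base_ray.
have -> : (ct v + 1 * cy v) * (ct v + -1 * cy v) = ct v ^+ 2 - cy v ^+ 2 by ring.
by split=> [[]|].
Qed.

(* The direction [w] avoids the hyperplane [t + e y = 0] in the future iff
   it lies in the cap of centre [cap_axis g e] and height [cap_height g e]. *)
Definition cap_axis g e := (cu (ty_row g e))^-1 *: spatial (ty_row g e).
Definition cap_height g e := (cu (ty_row g e))^-1 * ct (ty_row g e).

Lemma light_ray_cap g w s e : cu (ty_row g e) != 0 ->
  ct (ray g w s) + e * cy (ray g w s) =
    cu (ty_row g e) * (1 - s * (cap_height g e - dot (cap_axis g e) w)).
Proof.
move=> a0; rewrite light_ray_ty /cap_height /cap_axis dotZl; field.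
exact: a0.
Qed.

(** Along the ray, [t + e y] is a nonzero multiple of [1 - s * d], where [d] is what
    [dot (cap_axis g e) w] lacks to reach the height. It has a positive zero, [s = d^-1], exactly
    when [d > 0]. *)
Lemma cap_meets_ray g w e : cu (ty_row g e) != 0 ->
  cap_height g e <= dot (cap_axis g e) w <->
  forall s, 0 < s -> ct (ray g w s) + e * cy (ray g w s) != 0.
Proof.
move=> a0; split=> [le_w s s0 /=|P].
  rewrite light_ray_cap // mulf_neq0 // gt_eqF //.
  have : s * (cap_height g e - dot (cap_axis g e) w) <= 0.
    by rewrite pmulr_rle0 // subr_le0.
  lra.
rewrite leNgt; apply/negP => lt_w.
have d0 : 0 < cap_height g e - dot (cap_axis g e) w by rewrite subr_gt0.
have := P (cap_height g e - dot (cap_axis g e) w)^-1.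
rewrite invr_gt0 => /(_ d0); rewrite light_ray_cap // mulVf; last by rewrite gt_eqF.
by rewrite subrr mulr0 eqxx.
Qed.

Lemma cap_axis_sq g e : isometric lorentz_sign g -> e ^+ 2 = 1 ->
  cu (ty_row g e) != 0 ->
  dot (cap_axis g e) (cap_axis g e) = 1 + cap_height g e ^+ 2.
Proof.
move=> gP e1 a0; have := form_ty_row e e gP; rewrite formE -[e * e]expr2 e1 subrr.
rewrite /cap_axis /cap_height !dot_linear => /eqP; rewrite subr_eq0 => /eqP <-.
by field; apply: a0.
Qed.

Lemma cap_axis_dot g : isometric lorentz_sign g ->
    cu (ty_row g 1) != 0 -> cu (ty_row g (-1)) != 0 ->
  dot (cap_axis g 1) (cap_axis g (-1)) = cap_height g 1 * cap_height g (-1)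
    + 1 - 2 * (cu (ty_row g 1) * cu (ty_row g (-1)))^-1.
Proof.
move=> gP a0 b0; have := form_ty_row 1 (-1) gP; rewrite formE.
rewrite /cap_axis /cap_height !dot_linear => E.
have -> : dot (spatial (ty_row g 1)) (spatial (ty_row g (-1))) =
  cu (ty_row g 1) * cu (ty_row g (-1)) + ct (ty_row g 1) * ct (ty_row g (-1)) - 2.
  by lra.
by field; rewrite b0.
Qed.

Lemma BTZE v :
  BTZ R m.+3 v <-> quad (l := m.+3) v = 1 /\ ct v ^+ 2 - cy v ^+ 2 != 0.
Proof.
split=> [[v1 sv]|[v1 /eqP sv]]; split=> //; last by case.
by apply/eqP => E; apply: sv.
Qed.

Lemma free_light_ray g : isometric lorentz_sign g ->
    cu (ty_row g 1) != 0 -> cu (ty_row g (-1)) != 0 ->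
    (cu (ty_row g 1) * cu (ty_row g (-1)))^-1 <= 1 ->
  exists2 w, sphere R m.+1 w &
    forall s, 0 < s -> ~ singularity R m.+3 (ray g w s).
Proof.
move=> gP a0 b0 c1.
have [w w1 [/cap_meets_ray wp /cap_meets_ray wq]] :=
  caps_meet (cap_axis_sq gP (expr1n _ 2) a0)
    (cap_axis_sq gP (etrans (sqrrN 1) (expr1n _ 2)) b0) (cap_axis_dot gP a0 b0) c1.
exists w; first exact/sphereE.
move=> s s0 /singularity_light_ray => /(_ gP w1) /eqP; rewrite mulf_eq0.
by rewrite (negbTE (wp a0 s s0)) (negbTE (wq b0 s s0)).
Qed.

Lemma trapped_light_ray g w : isometric lorentz_sign g ->
    cu (ty_row g 1) != 0 -> cu (ty_row g (-1)) != 0 ->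
    1 < (cu (ty_row g 1) * cu (ty_row g (-1)))^-1 ->
    0 <= cap_height g 1 + cap_height g (-1) -> sphere R m.+1 w ->
  ~ forall s, 0 < s -> ~ singularity R m.+3 (ray g w s).
Proof.
move=> gP a0 b0 c1 h0 /sphereE w1 wP.
apply: (caps_disjoint (cap_axis_sq gP (expr1n _ 2) a0)
    (cap_axis_sq gP (etrans (sqrrN 1) (expr1n _ 2)) b0) (cap_axis_dot gP a0 b0)
    c1 h0 w1); apply/cap_meets_ray => // s s0 /=; apply/eqP => E;
  by apply: (wP s s0); apply/singularity_light_ray => //; rewrite E ?mulr0 ?mul0r.
Qed.

(** Right multiplication by a flip other than that of [u] gives another isometry over the same
    point. Reversing [t] negates both cap heights; reversing [x] changes the determinant and keeps
    the heights. *)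
Definition flip (i : 'I_m.+4) : 'M[R]_m.+4 :=
  diag_mx (\row_j if j == i then -1 else 1).

Lemma isometric_flip i : isometric lorentz_sign (flip i).
Proof.
by apply: isometric_diag => j; rewrite mxE; case: ifP => _; rewrite ?sqrrN expr1n.
Qed.

Lemma det_flip i : \det (flip i) = -1.
Proof.
rewrite det_diag (bigD1 i) //= mxE eqxx big1 ?mulr1 // => j /negbTE ji.
by rewrite mxE ji.
Qed.

Lemma flip_base i : i != ord0 -> flip i *m base_point R m.+3 = base_point R m.+3.
Proof.
move=> i0; apply/colP => j; rewrite mul_diag_mx !mxE.
case: (eqVneq j ord0) => [->|]; last by rewrite mulr0.
by rewrite eq_sym (negbTE i0) mul1r.
Qed.

Lemma ty_row_flip g i e j :
  Defs.coord (ty_row (g *m flip i) e) j =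
  (if inord j == i then -1 else 1) * Defs.coord (ty_row g e) j.
Proof.
rewrite /ty_row trmx_mul -mulmxA /flip tr_diag_mx /Defs.coord mul_diag_mx mxE.
by rewrite mxE.
Qed.

Lemma black_holeE : black_hole R m.+3 =
  [set v | quad (l := m.+3) v = 1 /\ 0 < ct v ^+ 2 - cy v ^+ 2 < 1].
Proof.
have prodE g : cu (ty_row g 1) * cu (ty_row g (-1)) =
    ct (g *m base_point R m.+3) ^+ 2 - cy (g *m base_point R m.+3) ^+ 2.
  by rewrite !cu_ty_row; ring.
apply/seteqP; split=> v.
  move=> [/BTZE[v1 v0] vF]; split=> //.
  (* Outside the interval from 0 to 1, the nonzero product [ab] is negative or at least 1. Either
     way [ab^-1 <= 1], so every representative has an escaping direction. *)
  apply: contrapT => vN; apply: vF; split; first exact/BTZE.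
  move=> g [/SO_isometric[_ gP] gv]; have := prodE g; rewrite gv => ab.
  move: (v0); rewrite -ab mulf_eq0 negb_or => /andP[a0 b0].
  apply: free_light_ray => //; rewrite ab.
  have [lt0|] := ltP 0 (ct v ^+ 2 - cy v ^+ 2); last first.
    by move=> le0; rewrite (le_trans _ ler01) // invr_le0.
  rewrite invf_le1 // leNgt; apply/negP => lt1; apply: vN.
  by rewrite lt0.
move=> [v1 /andP[lt0 lt1]].
have v0 : ct v ^+ 2 - cy v ^+ 2 != 0 by rewrite gt_eqF.
split; first exact/BTZE.
move=> [_ vF].
have [g0 g0P g0v] :
    exists2 g, isometric lorentz_sign g & g *m base_point R m.+3 = v.
  have q1 : form (base_point R m.+3) (base_point R m.+3) = 1.
    by rewrite /base_point diag_form_delta mxE !eqxx mulr1.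
  by apply: isometric_transitive; rewrite q1 ?oner_neq0 // -quadE v1.
have t0 : inord 1 != ord0 :> 'I_m.+4.
  by rewrite -inord0E -(inj_eq val_inj) /= !inordK.
have x0 : inord 2 != ord0 :> 'I_m.+4.
  by rewrite -inord0E -(inj_eq val_inj) /= !inordK.
(* A time reversal, if necessary, makes the sum of the heights nonnegative. *)
have [g1 [g1P g1v h1]] : exists g, [/\ isometric lorentz_sign g,
    g *m base_point R m.+3 = v & 0 <= cap_height g 1 + cap_height g (-1)].
  have [h0|h0] := leP 0 (cap_height g0 1 + cap_height g0 (-1)); first by exists g0.
  exists (g0 *m flip (inord 1)); split.
  - by apply: isometricM => //; apply: isometric_flip.
  - by rewrite -mulmxA flip_base.
  - rewrite /cap_height !ty_row_flip eqxx eq_sym inord0E (negbTE t0).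
    by move: h0; rewrite /cap_height; lra.
(* A reversal of [x], if necessary, brings the determinant to 1. *)
have [g [gS gv h]] : exists g, [/\ SO R m.+3 g,
    g *m base_point R m.+3 = v & 0 <= cap_height g 1 + cap_height g (-1)].
  have /eqP := isometric_det lorentz_sign_sq g1P; rewrite sqrf_eq1 => /orP[]/eqP d.
    by exists g1; split=> //; apply/SO_isometric.
  exists (g1 *m flip (inord 2)); split.
  - apply/SO_isometric; split; first by rewrite det_mulmx d det_flip mulrNN mulr1.
    by apply: isometricM => //; apply: isometric_flip.
  - by rewrite -mulmxA flip_base.
  - rewrite /cap_height !ty_row_flip eq_sym inord0E (negbTE x0).
    rewrite (_ : (inord 1 == inord 2 :> 'I_m.+4) = false) ?mul1r //.
    by rewrite -(inj_eq val_inj) /= !inordK.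
have [w wS wP] := vF g (conj gS gv).
have /SO_isometric[_ gP] := gS.
have ab := prodE g; rewrite gv in ab.
move: (v0); rewrite -ab mulf_eq0 negb_or => /andP[a0 b0].
apply: (trapped_light_ray gP a0 b0 _ h wS wP).
by rewrite ab invf_gt1.
Qed.

End BlackHole.

(** * The horizon as the boundary of the black hole *)

Section Horizon.
Variables (R : realType) (m : nat).
Notation V := 'cV[R]_m.+4.
Implicit Types v : V.

Definition ty_norm v : R := ct v ^+ 2 - cy v ^+ 2.

Lemma ty_norm_continuous : continuous (ty_norm : V -> R).
Proof.
have sq i : continuous (fun v : V => v i 0 ^+ 2).
  move=> v; under eq_fun do rewrite expr2.
  by apply: continuousM; exact: coord_continuous.
by move=> v; exact: cvgB (sq _ v) (sq _ v).
Qed.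

(** The direction [e_t - e_y] is null, orthogonal to [e_u], and its product with [v] is [t + y]. The
    norm of the result is therefore affine in [y], and when [t + y] is nonzero a choice of [y]
    brings the point back to AdS for any [x]. *)
Definition horizon_push v (x y : R) : V :=
  v + (x *: base_point R m.+3 + y *: (@e_t R m + (-1) *: @e_y R m)).

Lemma quad_horizon_push v x y : quad (l := m.+3) (horizon_push v x y) =
  quad (l := m.+3) v + x ^+ 2 + 2 * x * cu v + 2 * y * (ct v + cy v).
Proof.
have kk := @form_ty R m (-1) (-1); rewrite mulrNN mulr1 subrr in kk.
have kv :
    diag_form (@lorentz_sign R m) (@e_t R m + (-1) *: @e_y R m) v = ct v + cy v.
  rewrite !diag_formE !diag_form_delta /lorentz_sign !inordK //=.
  by rewrite /Defs.coord; ring.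
rewrite !quadE /horizon_push; move: kk kv; set k := @e_t R m + _ => kk kv.
have ku : diag_form (@lorentz_sign R m) k (base_point R m.+3) = 0.
  rewrite diag_formC /base_point diag_form_delta /k !mxE.
  by rewrite -!(inj_eq val_inj) /= !inordK // mulr0 addr0 mulr0.
have uv : diag_form (@lorentz_sign R m) (base_point R m.+3) v = cu v.
  by rewrite diag_form_delta mul1r /Defs.coord inord0E.
have uu : diag_form (@lorentz_sign R m) (base_point R m.+3) (base_point R m.+3) = 1.
  by rewrite diag_form_delta mul1r mxE !eqxx.
clearbody k; rewrite !diag_formE kk (diag_formC _ v k) kv.
rewrite (diag_formC _ v) uv uu (diag_formC _ _ k) ku; ring.
Qed.

Lemma ty_norm_horizon_push v x y :
  ty_norm (horizon_push v x y) = ty_norm v + 2 * y * (ct v + cy v).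
Proof.
rewrite /ty_norm /Defs.coord !mxE.
by rewrite -!(inj_eq val_inj) /= !inordK //= /Defs.coord; ring.
Qed.

Lemma horizonE : horizon R m.+3 =
  [set v | quad (l := m.+3) v = 1 /\ ty_norm v = 1].
Proof.
have near_in v : 0 < ty_norm v < 1 -> \forall w \near v, 0 < ty_norm w < 1.
  move=> v01.
  have N01 : nbhs (ty_norm v) `]0, 1[%classic.
    by apply: open_nbhs_nbhs; split; [exact: interval_open | rewrite /= in_itv].
  have : nbhs v (ty_norm @^-1` `]0, 1[%classic) by exact: ty_norm_continuous.
  by apply: filterS => w; rewrite /= in_itv.
apply/seteqP; split=> v; rewrite /horizon /boundary black_holeE.
  move=> [vC vI].
  (* A point outside BTZ is isolated in the subspace topology, so it would have to belong to the
     black hole to be in its closure. *)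
  have [vB|vB] := pselect (BTZ R m.+3 v); last first.
    have : nbhs (v : subspace (BTZ R m.+3)) [set v].
      by rewrite /nbhs /= -nbhs_subspace_out.
    move=> /vC [w [[w1 w01] /= wv]]; case: vB; rewrite -wv; apply/BTZE.
    by split=> //; case/andP: w01 => w0 _; rewrite gt_eqF.
  have [v1 v0] := (BTZE v).1 vB.
  have near_meets (A : set R) : open A -> A (ty_norm v) ->
      exists2 x, A x & 0 < x < 1.
    move=> Ao Av.
    have : nbhs (v : subspace (BTZ R m.+3)) (ty_norm @^-1` A).
      rewrite nbhs_subspace_ex //; exists (ty_norm @^-1` A) => //.
      by apply: ty_norm_continuous; apply: open_nbhs_nbhs.
    by move=> /vC [w [[w1 w01] Aw]]; exists (ty_norm w).
  split=> //; apply/eqP; rewrite eq_le; apply/andP; split.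
    rewrite leNgt; apply/negP => gt1.
    have [x /= + /andP[_ x1]] := near_meets _ (@open_gt R 1) gt1.
    by rewrite ltNge (ltW x1).
  rewrite leNgt; apply/negP => lt1.
  have [lt0|le0] := ltP 0 (ty_norm v).
    apply: vI; apply/nbhs_subspace_ex => //.
    exists (ty_norm @^-1` `]0, 1[%classic).
      have := near_in v; rewrite lt0 lt1 => /(_ isT).
      by apply: filterS => w; rewrite /= in_itv.
    apply/seteqP; split=> w /= [w01 wB]; split=> //.
      by case: w01 => _; rewrite in_itv.
    by have [w1 _] := (BTZE w).1 wB; split=> //; rewrite in_itv in w01.
  have {}lt0 : ty_norm v < 0 by rewrite lt_neqAle v0.
  have [x /= + /andP[x0 _]] := near_meets _ (@open_lt R 0) lt0.
  by rewrite ltNge (ltW x0).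
move=> [v1 D1].
have vB : BTZ R m.+3 v.
  by apply/BTZE; split=> //; rewrite -/(ty_norm v) D1 oner_neq0.
split; last first.
  by move=> /nbhs_singleton [_]; rewrite -/(ty_norm v) D1 ltxx andbF.
move=> B; rewrite nbhs_subspace_ex // => -[A Av AB].
pose u := cu v; pose a := ct v + cy v.
have a0 : a != 0.
  apply/eqP => a0; have : ty_norm v = a * (ct v - cy v).
    by rewrite /ty_norm /a; ring.
  by rewrite a0 mul0r D1 => /eqP; rewrite oner_eq0.
(* The path moves [u] away from 0, so that [u ^+ 2] grows, and [eta] solves the equation of AdS. As
   [sg * u = |u|], [ty_norm] drops to [1 - e ^+ 2 - 2 |u| e], below 1 for every [e > 0]: the path
   enters the black hole from [v]. *)
pose sg : R := if 0 <= u then 1 else -1.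
have sg2 : sg ^+ 2 = 1 by rewrite /sg; case: ifP => _; rewrite ?sqrrN expr1n.
have sgu : 0 <= sg * u.
  rewrite /sg; have [u0|/ltW u0] := leP 0 u; first by rewrite mul1r.
  by rewrite mulN1r oppr_ge0.
pose eta e := - (e ^+ 2 + 2 * (sg * u) * e) / (2 * a).
pose path e := horizon_push v (sg * e) (eta e).
have path1 e : quad (l := m.+3) (path e) = 1.
  rewrite quad_horizon_push v1 exprMn sg2 -/u -/a /eta; field.
  exact: a0.
have pathD e : ty_norm (path e) = 1 - e ^+ 2 - 2 * (sg * u) * e.
  rewrite ty_norm_horizon_push D1 -/a /eta; field.
  exact: a0.
have path_cvg : path e @[e --> 0^'+] --> v.
  have id_cvg : e @[e --> (0:R)^'+] --> (0 : R) by apply: cvg_within.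
  have -> : nbhs v = nbhs (v + ((sg * 0) *: base_point R m.+3 +
      (- (0 * 0 + 2 * (sg * u) * 0) / (2 * a)) *: (@e_t R m + (-1) *: @e_y R m))).
    by rewrite !mulr0 addr0 oppr0 mul0r !scale0r !addr0.
  apply: cvgD; first exact: cvg_cst.
  apply: cvgD; apply: cvgZr_tmp; first by apply: cvgM => //; exact: cvg_cst.
  apply: cvgM; last exact: cvg_cst.
  apply: cvgN; apply: cvgD.
    by under eq_fun do rewrite expr2; apply: cvgM.
  by apply: cvgM => //; exact: cvg_cst.
have nearA : \forall e \near 0^'+, A (path e) by apply: path_cvg.
have near0 : \forall e \near 0^'+, 0 < ty_norm (path e).
  have Dv : 0 < ty_norm v by rewrite D1.
  have : ty_norm (path e) @[e --> 0^'+] --> ty_norm v.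
    by apply: cvg_comp path_cvg _; apply: ty_norm_continuous.
  by move=> /cvgr_gt; apply.
have [e [[e0 Ae] De]] : exists e, (0 < e /\ A (path e)) /\ 0 < ty_norm (path e).
  apply: (@filter_ex _ (0:R)^'+); near=> e; split; [split|]; near: e => //.
  by apply: nbhs_right_gt.
have eD : 0 < ty_norm (path e) < 1.
  rewrite De pathD /=.
  have : 0 <= 2 * (sg * u) * e.
    by apply: mulr_ge0; [apply: mulr_ge0 | apply: ltW].
  have : 0 < e ^+ 2 by rewrite exprn_gt0.
  lra.
have eB : BTZ R m.+3 (path e).
  by apply/BTZE; split=> //; case/andP: eD => /gt_eqF; rewrite /ty_norm => ->.
exists (path e); split; first by [].
suff : (A `&` BTZ R m.+3) (path e) by rewrite -AB => -[].
by [].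
Unshelve. all: by end_near. Qed.

End Horizon.

(** * Exponentials of nilpotent matrices *)

Section Exponential.
Variables (R : realType) (n : nat).

(** The partial sums of the series are constant from three terms on. *)
Lemma mx_exp_nilpotent3 (X : 'M[R]_n.+1) : X ^+ 3 = 0 ->
  mx_exp X = 1 + X + 2^-1 *: X ^+ 2.
Proof.
move=> X3; apply: norm_lim_near_cst; exists 3%N => // k /= k3.
rewrite /series /= (big_cat_nat (leq0n 3) k3) /=.
rewrite [X in _ + X]big_nat_cond [X in _ + X]big1.
  rewrite !big_nat_recr //= big_nil add0r addr0.
  by rewrite !invr1 !scale1r expr0 expr1.
move=> i /andP[/andP[i3 _] _].
by rewrite -(subnK i3) exprD X3 mulr0 scaler0.
Qed.

Lemma eq_mulmx_col (A B : 'M[R]_n) :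
  (forall v : 'cV[R]_n, A *m v = B *m v) -> A = B.
Proof.
by move=> AB; apply/trmx_inj/row_matrixP => j; rewrite -!tr_col !colE AB.
Qed.

End Exponential.

(** * The two flows and the horizons in coordinates *)

Section Coordinates.
Variable R : realType.
Implicit Types (u t x y z a : R).

Lemma cu_vec5 u t x y z : cu (vec5 u t x y z) = u.
Proof. by rewrite /Defs.coord mxE inordK. Qed.
Lemma ct_vec5 u t x y z : ct (vec5 u t x y z) = t.
Proof. by rewrite /Defs.coord mxE inordK. Qed.
Lemma cx_vec5 u t x y z : cx (vec5 u t x y z) = x.
Proof. by rewrite /Defs.coord mxE inordK. Qed.
Lemma cy_vec5 u t x y z : cy (vec5 u t x y z) = y.
Proof. by rewrite /Defs.coord mxE inordK. Qed.
Lemma cz_vec5 u t x y z : cz (vec5 u t x y z) = z.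
Proof. by rewrite /Defs.coord mxE inordK. Qed.

Definition vec5E := (cu_vec5, ct_vec5, cx_vec5, cy_vec5, cz_vec5).

Lemma ord_inord n (i : 'I_n.+1) k : val i = k -> i = inord k.
Proof. by move=> <-; rewrite inord_val. Qed.

Lemma vec5_coord (v : 'cV[R]_5) : v = vec5 (cu v) (ct v) (cx v) (cy v) (cz v).
Proof.
apply/colP => i; rewrite mxE /Defs.coord.
by case: i => [[|[|[|[|[|]]]]] i5] //=; congr (v _ _); apply/ord_inord.
Qed.

Lemma vec5D u t x y z u' t' x' y' z' :
  vec5 u t x y z + vec5 u' t' x' y' z' =
  vec5 (u + u') (t + t') (x + x') (y + y') (z + z').
Proof.
apply/colP => i; rewrite !mxE.
by case: i => [[|[|[|[|[|]]]]] i5].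
Qed.

Lemma vec5Z a u t x y z :
  a *: vec5 u t x y z = vec5 (a * u) (a * t) (a * x) (a * y) (a * z).
Proof.
apply/colP => i; rewrite !mxE.
by case: i => [[|[|[|[|[|]]]]] i5].
Qed.

Lemma vec50 : vec5 0 0 0 0 0 = 0 :> 'cV[R]_5.
Proof.
apply/colP => i; rewrite !mxE.
by case: i => [[|[|[|[|[|]]]]] i5].
Qed.

Lemma quad4E (v : 'cV[R]_4) :
  quad (l := 3) v = cu v ^+ 2 + ct v ^+ 2 - cx v ^+ 2 - cy v ^+ 2.
Proof.
rewrite /quad !big_ord_recl big_ord0 /= addr0 !addrA /Defs.coord.
by congr (v _ _ ^+ 2 + v _ _ ^+ 2 - v _ _ ^+ 2 - v _ _ ^+ 2); apply/ord_inord.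
Qed.

Lemma quad5E (v : 'cV[R]_5) :
  quad (l := 4) v = cu v ^+ 2 + ct v ^+ 2 - cx v ^+ 2 - cy v ^+ 2 - cz v ^+ 2.
Proof.
rewrite /quad !big_ord_recl big_ord0 /= addr0 !addrA /Defs.coord.
by congr (v _ _ ^+ 2 + v _ _ ^+ 2 - v _ _ ^+ 2 - v _ _ ^+ 2 - v _ _ ^+ 2);
  apply/ord_inord.
Qed.

(** On the image of [X0p] one has [u = x], so a second application leaves only multiples of
    [(1, 0, 1, 0, 0)], which [X0p] kills. *)
Lemma X0p_nilpotent a : (a *: X0p R) ^+ 3 = 0.
Proof.
rewrite exprZn; suff -> : X0p R ^+ 3 = 0 by rewrite scaler0.
apply: eq_mulmx_col => v; rewrite !exprS expr0 mulr1 -!mulmxE -!mulmxA !X0pE.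
by rewrite /X0p_map !vec5E mul0mx !subrr vec50.
Qed.

Lemma X0m_nilpotent a : (a *: X0m R) ^+ 3 = 0.
Proof.
rewrite exprZn; suff -> : X0m R ^+ 3 = 0 by rewrite scaler0.
apply: eq_mulmx_col => v; rewrite !exprS expr0 mulr1 -!mulmxE -!mulmxA !X0mE.
by rewrite /X0m_map !vec5E mul0mx !subrr oppr0 vec50.
Qed.

Lemma mx_exp_X0p a u t x y z :
  let d := a * z + a ^+ 2 / 2 * (u - x) in
  mx_exp (a *: X0p R) *m vec5 u t x y z =
  vec5 (u + d) t (x + d) y (z + a * (u - x)).
Proof.
rewrite /= mx_exp_nilpotent3 ?X0p_nilpotent // exprZn (expr2 (X0p R)) -mulmxE.
rewrite !mulmxDl mul1mx -!scalemxAl -!mulmxA !X0pE /X0p_map !vec5E !vec5Z !vec5D.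
by congr vec5; field.
Qed.

Lemma mx_exp_X0m a u t x y z :
  let d := a * z + a ^+ 2 / 2 * (u + x) in
  mx_exp (a *: X0m R) *m vec5 u t x y z =
  vec5 (u + d) t (x - d) y (z + a * (u + x)).
Proof.
rewrite /= mx_exp_nilpotent3 ?X0m_nilpotent // exprZn (expr2 (X0m R)) -mulmxE.
rewrite !mulmxDl mul1mx -!scalemxAl -!mulmxA !X0mE /X0m_map !vec5E !vec5Z !vec5D.
by congr vec5; field.
Qed.

(** An isometry has determinant 1 or -1, so its square has determinant 1. Applied to the flow at
    time [a / 2], this replaces the computation of a determinant. *)
Lemma SO_square (g h : 'M[R]_5) : g = h *m h ->
    (forall v, quad (l := 4) (h *m v) = quad (l := 4) v) ->
  SO R 4 g.
Proof.
move=> -> hP; split; last by move=> v; rewrite -mulmxA !hP.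
rewrite det_mulmx -expr2; apply: (isometric_det (@lorentz_sign_sq R 1)).
by move=> v; rewrite -!quadE hP.
Qed.

Lemma one_param_X0p_SO : one_param (X0p R) `<=` SO R 4.
Proof.
move=> _ [a _ <-]; apply: (@SO_square _ (mx_exp ((a / 2) *: X0p R))) => [|v].
  apply: eq_mulmx_col => v; rewrite (vec5_coord v) -mulmxA !mx_exp_X0p.
  by congr vec5; field.
by rewrite [in LHS](vec5_coord v) mx_exp_X0p !quad5E !vec5E; field.
Qed.

Lemma one_param_X0m_SO : one_param (X0m R) `<=` SO R 4.
Proof.
move=> _ [a _ <-]; apply: (@SO_square _ (mx_exp ((a / 2) *: X0m R))) => [|v].
  apply: eq_mulmx_col => v; rewrite (vec5_coord v) -mulmxA !mx_exp_X0m.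
  by congr vec5; field.
by rewrite [in LHS](vec5_coord v) mx_exp_X0m !quad5E !vec5E; field.
Qed.

Lemma horizon3E (v : 'cV[R]_4) : horizon R 3 v <->
  ct v ^+ 2 - cy v ^+ 2 = 1 /\ cu v ^+ 2 = cx v ^+ 2.
Proof.
rewrite horizonE /= quad4E /ty_norm.
by split=> -[v1 v2]; split; lra.
Qed.

Lemma horizon4E (v : 'cV[R]_5) : horizon R 4 v <->
  ct v ^+ 2 - cy v ^+ 2 = 1 /\ cu v ^+ 2 = cx v ^+ 2 + cz v ^+ 2.
Proof.
rewrite horizonE /= quad5E /ty_norm.
by split=> -[v1 v2]; split; lra.
Qed.

Lemma incl_horizon3 u t x y : t ^+ 2 - y ^+ 2 = 1 -> u ^+ 2 = x ^+ 2 ->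
  (@incl34 R @` horizon R 3) (vec5 u t x y 0).
Proof.
move=> ty ux; exists (\col_(i < 4) [:: u; t; x; y]`_i).
  by apply/horizon3E; rewrite /Defs.coord !mxE !inordK.
by rewrite /incl34 /Defs.coord !mxE !inordK.
Qed.

(** A flow that preserves the quadratic form together with [t] and [y] preserves
    [u ^+ 2 - x ^+ 2 - z ^+ 2], which vanishes on the included horizon. *)
Lemma one_param_horizon (X : 'M[R]_5) : one_param X `<=` SO R 4 ->
    (forall a (v : 'cV[R]_5),
      ct (mx_exp (a *: X) *m v) = ct v /\ cy (mx_exp (a *: X) *m v) = cy v) ->
  group_image (one_param X) (@incl34 R @` horizon R 3) `<=` horizon R 4.
Proof.
move=> XSO Xty _ [g [a _ <-] [_ [v /horizon3E[ty ux] <-] <-]].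
have [_ gP] : SO R 4 (mx_exp (a *: X)) by apply: XSO; exists a.
have := gP (incl34 v); have [tE yE] := Xty a (incl34 v).
rewrite !quad5E tE yE => E; apply/horizon4E; rewrite tE yE.
by move: E; rewrite /incl34 !vec5E => E; split; lra.
Qed.

End Coordinates.

(** * The horizon in dimension four *)

Theorem theorem11 (R : realType) :
  [/\ one_param (X0p R) `<=` SO R 4,
      one_param (X0m R) `<=` SO R 4,
      horizon R 4 =
        group_image (one_param (X0p R)) (@incl34 R @` horizon R 3) `|`
        group_image (one_param (X0m R)) (@incl34 R @` horizon R 3)
    & horizon R 4 =
        [set v : 'cV[R]_5 |
          AdS R 4 v /\ cu v ^+ 2 - cx v ^+ 2 - cz v ^+ 2 = 0]].
Proof.
split; [exact: one_param_X0p_SO|exact: one_param_X0m_SO| |]; last first.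
  apply/seteqP; split=> v.
    by move=> /horizon4E[ty ux]; rewrite /AdS /= quad5E; split; lra.
  by rewrite /AdS /= quad5E => -[v1 uxz]; apply/horizon4E; split; lra.
apply/seteqP; split; last first.
  rewrite subUset; split; apply: one_param_horizon.
  - exact: one_param_X0p_SO.
  - by move=> a v; rewrite (vec5_coord v) mx_exp_X0p !vec5E.
  - exact: one_param_X0m_SO.
  - by move=> a v; rewrite (vec5_coord v) mx_exp_X0m !vec5E.
(* The flow of [X0p] preserves [u - x] and moves [z] at speed [u - x]: it sweeps
   the cone [u ^+ 2 = x ^+ 2 + z ^+ 2] out of its line [u = - x], [z = 0], except
   for the line [u = x], [z = 0], which it fixes pointwise. *)
move=> v /horizon4E[ty uxz]; left.
have [ux|ux] := eqVneq (cu v) (cx v).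
  have z0 : cz v = 0.
    by apply/eqP; rewrite -sqrf_eq0; apply/eqP; move: uxz; rewrite ux; lra.
  exists (mx_exp (0 *: X0p R)); first by exists 0.
  exists v; first by rewrite (vec5_coord v) z0 ux; apply: incl_horizon3.
  by rewrite [in LHS](vec5_coord v) mx_exp_X0p [RHS]vec5_coord; congr vec5; ring.
have d0 : cu v - cx v != 0 by rewrite subr_eq0.
(* The invariant [u - x] equals [2 u] on the line [u = - x], which fixes the starting point; [z]
   grows from 0 at speed [u - x], which fixes the time. *)
pose u0 := (cu v - cx v) / 2.
exists (mx_exp ((cz v / (cu v - cx v)) *: X0p R)).
  by exists (cz v / (cu v - cx v)).
exists (vec5 u0 (ct v) (- u0) (cy v) 0).
  by apply: incl_horizon3 => //; rewrite sqrrN.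
(* The equation of the cone makes the displacement [z ^+ 2 / (2 (u - x))] equal to [(u + x) / 2],
   which takes [u0] to [u] and [- u0] to [x]. *)
have zz : cz v ^+ 2 = (cu v - cx v) * (cu v + cx v) by move: uxz; nra.
rewrite mx_exp_X0p [RHS]vec5_coord exprMn zz /u0; congr vec5; field => //.
Qed.
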